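(* Let $M$ be a topological space and let $G$ be a finite group acting on $M$ from the right by homeomorphisms. Let $\mathrm{K}\trianglelefteq G$ be the kernel of the action, and assume that the induced action $x(g\mathrm{K})=xg$ of $G/\mathrm{K}$ on $M$ is fixed point free. Let $\mathrm{E}\subset M$ be an elementary domain for the action of $G$, let $\mathrm{H}\le G$ be any subgroup, and let $S\in\overline{\mathcal S}$ be an admissible set of representatives of the left cosets of $\mathrm{H}$ in $G$. Then $$\mathrm{E}S=\bigcup_{s\in S}\mathrm{E}s$$ is an elementary domain for the action of $\mathrm{H}$ on $M$.
   Context: Elementary domain: for a right action of a finite group $\Gamma$ on $M$ by homeomorphisms, with kernel $\mathrm{K}_\Gamma$ (the set of elements of $\Gamma$ acting as the identity), an elementary domain is an open subset $\mathrm{E}\subset M$ such that (A) for any $g_1,g_2\in\Gamma$ such that $g_1\neq g_2k$ for all $k\in \mathrm{K}_\Gamma$, one has $\mathrm{E}g_1\cap\overline{\mathrm{E}}g_2=\varnothing$; (B) $\bigcup_{g\in\Gamma}\overline{\mathrm{E}}g=M$. Here the bar denotes topological closure. For $\Gamma=\mathrm{H}$ (acting by restriction), the kernel is $\mathrm{K}\cap\mathrm{H}$. Fixed point free: no non-identity element of the group fixes any point. Admissible sets $\overline{\mathcal S}$: put $\omega=|\mathrm{K}|/|\mathrm{K}\cap\mathrm{H}|$ and $\theta=|G||\mathrm{H}\cap\mathrm{K}|/(|\mathrm{H}||\mathrm{K}|)$. A choice of coset representatives of $\mathrm{K}/(\mathrm{K}\cap\mathrm{H})$ is a set $\sigma=\{\sigma_1,\dots,\sigma_\omega\}\subset\mathrm{K}$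 containing exactly one element of each left coset of $\mathrm{K}\cap\mathrm{H}$ in $\mathrm{K}$. Choose successively elements $g_1,\dots,g_\theta\in G$ and, for each $\nu$, a choice $\sigma^{(\nu)}=\{\sigma^{(\nu)}_1,\dots,\sigma^{(\nu)}_\omega\}$ of coset representatives of $\mathrm{K}/(\mathrm{K}\cap\mathrm{H})$ (the choices for different $\nu$ may be equal or different), such that for each $\nu\geq2$ the element $g_\nu$ belongs to none of the cosets $g_\lambda\sigma^{(\lambda)}_\mu\mathrm{H}$ with $\lambda<\nu$, $1\le\mu\le\omega$. The set $S=\{g_\nu\sigma^{(\nu)}_\mu:\ 1\le\nu\le\theta,\ 1\le\mu\le\omega\}$ is then called admissible, and $\overline{\mathcal S}$ is the collection of all admissible sets. Every admissible set is a complete set of representatives of the left cosets of $\mathrm{H}$ in $G$. *)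

(* Defs.v *)
From mathcomp Require Export all_boot all_fingroup.
From mathcomp Require Export boolp classical_sets topology.

Set Implicit Arguments.
Unset Strict Implicit.
Unset Printing Implicit Defensive.

Local Open Scope classical_set_scope.
Local Open Scope group_scope.

(* An action D M is a right action: to x (g * h) = to (to x g) h for g, h in D;
   outside D only injectivity of to^~ g is required, and no definition below
   depends on those values.  The library's stabilisers and quotient actions
   require a finite set acted upon, hence the versions below. *)

Definition homeomorphism (M N : topologicalType) (f : M -> N) : Prop :=
  continuous f /\
  exists f' : N -> M, [/\ continuous f', cancel f f' & cancel f' f].

Definition acts_by_homeomorphisms (gT : finGroupType) (D : {group gT})
    (M : topologicalType) (to : action D M) : Prop :=
  {in D, forall g, homeomorphism (to^~ g)}.

Definition fixed_point_free (gT : finGroupType) (D : {group gT})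
    (M : Type) (to : action D M) : Prop :=
  forall g, g \in D -> g != 1 -> forall x, to x g <> x.

Section Kernel.

Variables (gT : finGroupType) (D : {group gT}) (M : Type) (to : action D M).

Definition actker : {set gT} :=
  finset (fun g => (g \in D) && `[< forall x, to x g = x >]).

Let toM x : {in D &, act_morph to x}.
Proof. by case: to => ? []. Qed.

Let to_inj : left_injective to.
Proof. by case: to => ? []. Qed.

Let to1 x : to x 1 = x.
Proof. by apply: (to_inj (x := 1)); rewrite -toM ?mulg1. Qed.

Lemma actkerP g : reflect (g \in D /\ forall x, to x g = x) (g \in actker).
Proof.
rewrite inE; apply: (iffP andP) => -[Dg kg]; split=> //; exact/asboolP.
Qed.

Lemma actker_group_set : group_set actker.
Proof.
apply/group_setP; split=> [|g h /actkerP[Dg kg] /actkerP[Dh kh]].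
  by apply/actkerP; split=> [|x]; rewrite ?group1 // to1.
by apply/actkerP; split=> [|x]; rewrite ?groupM // toM // kg kh.
Qed.
Canonical actker_group := Group actker_group_set.

Lemma actker_normal : actker <| D.
Proof.
apply/normalP; split=> [|g Dg]; first by apply/fintype.subsetP=> g /actkerP[].
have conj h u : h \in D -> u \in actker -> u ^ h \in actker.
  move=> Dh /actkerP[Du ku]; apply/actkerP; split=> [|x]; first exact: groupJ.
  by rewrite conjgE !toM ?groupM ?groupV // ku -toM ?groupV // mulVg to1.
apply/setP=> u; rewrite mem_conjg; apply/idP/idP => [ku|]; last first.
  by apply: conj; rewrite groupV.
by rewrite -(conjgKV g u); apply: conj.
Qed.

Definition kquo (x : M) (u : coset_of actker) : M := to x (repr u).

Lemma kquoE x g : g \in D -> kquo x (coset actker g) = to x g.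
Proof.
move=> Dg; have Ng := fintype.subsetP (normal_norm actker_normal) g Dg.
rewrite /kquo val_coset //; case: repr_rcosetP => k /actkerP[Dk kk].
by rewrite toM // kk.
Qed.

Lemma kquo_is_action : is_action (D / actker) kquo.
Proof.
split=> [u x y|x _ _ /morphimP[g Ng Dg ->] /morphimP[h Nh Dh ->]].
  exact: to_inj.
by rewrite /= -morphM // !kquoE ?groupM // toM.
Qed.
Definition kquo_action : action (D / actker) M := Action kquo_is_action.

End Kernel.

Lemma actker_ract (gT : finGroupType) (G H : {group gT}) (sHG : H \subset G)
    (M : Type) (to : action G M) :
  actker (to \ sHG) = actker to :&: H.
Proof.
apply/setP=> g; rewrite finset.in_setI.
apply/actkerP/andP => [[Hg kg]|[/actkerP[_ kg] Hg]] //; split=> //.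
by apply/actkerP; split; first exact: (fintype.subsetP sHG).
Qed.

Definition elementary_domain (gT : finGroupType) (D : {group gT})
    (M : topologicalType) (to : action D M) (E : set M) : Prop :=
  [/\ open E,
      forall g1 g2, g1 \in D -> g2 \in D ->
        (forall k, k \in actker to -> g1 <> g2 * k) ->
        (to^~ g1 @` E) `&` (to^~ g2 @` closure E) = set0
    & \bigcup_(g in [set` D]) (to^~ g @` closure E) =
        setT].

Section Admissible.

Variables (gT : finGroupType) (G : {group gT}) (M : Type) (to : action G M).
Variable H : {group gT}.

Local Notation K := (actker_group to).

Definition coset_reps (sigma : {set gT}) : Prop :=
  sigma \subset K /\
  forall A, A \in lcosets (K :&: H) K -> #|sigma :&: A| = 1%N.

Definition theta : nat := (#|G| * #|H :&: K|) %/ (#|H| * #|K|).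

(* The sets sigma nu are not enumerated: by coset_reps each of them has
   |K| / |K :&: H| elements.  The indices nu start at 0. *)
Definition admissible (S : {set gT}) : Prop :=
  exists (g : 'I_theta -> gT) (sigma : 'I_theta -> {set gT}),
    [/\ forall nu, g nu \in G,
        forall nu, coset_reps (sigma nu),
        forall (nu lambda : 'I_theta) s, (lambda < nu)%N -> s \in sigma lambda ->
          g nu \notin (g lambda * s) *: H
      & forall t, t \in S <->
          exists nu s, s \in sigma nu /\ t = g nu * s].

End Admissible.

(* Main.v *)
Require Import Defs.

(** Write [K] for the kernel of the action.  It is normal in [G], so [K <*> H]
    is the product of [K] and [H].  In an admissible family, [g nu] avoids
    [g lambda * s * H] for all [s] in [sigma lambda].  As [sigma lambda] meets
    every coset of [K :&: H] in [K], this says that [g nu] is outside the coset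
    [g lambda *: (K <*> H)].  The [g nu] thus represent distinct left cosets of
    [K <*> H] in [G], and [theta] is the number of these cosets, so every one of
    them is reached.  Two properties of [S] follow.

    - [admissible_cover]: every element of [G] is [s * h] with [s] in [S] and
      [h] in [H].

    - [admissible_same_coset]: two elements of [S] that agree modulo [K <*> H]
      already agree modulo [K], because they share the same index [nu].

    Homeomorphisms commute with closure and [S] is finite, so the closure of
    [E S] is the union of the [closure E] translated by [s].  Covering by [H]
    is then [admissible_cover].  For disjointness, if the translates of [E] by
    [s * h1] and of [closure E] by [t * h2] meet, then condition (A) for [G]
    gives [s * h1 = t * h2 * k] with [k] in [K]; by [admissible_same_coset]
    [t^-1 * s] is in [K], hence so is [h2^-1 * h1] by normality, and [h1], [h2]
    differ by an element of the kernel of the action of [H]. *)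

Set Implicit Arguments.
Unset Strict Implicit.

Local Open Scope classical_set_scope.
Local Open Scope group_scope.

(** * Homeomorphisms, closures and finite unions *)

Section Homeomorphism.

Variables (M N : topologicalType) (f : M -> N).
Hypothesis homeo_f : homeomorphism f.

(** Openness and closedness of images both reduce to continuity of the inverse
    map through this identity. *)
Lemma homeomorphism_image_preimage :
  exists2 f' : N -> M, continuous f' & forall A, f @` A = f' @^-1` A.
Proof.
case: homeo_f => _ [f' [cf' fK f'K]]; exists f' => // A.
apply/seteqP; split=> [_ [x Ax <-]|y Ay] /=; first by rewrite fK.
by exists (f' y).
Qed.

Lemma homeomorphism_open_image A : open A -> open (f @` A).
Proof.
by case: homeomorphism_image_preimage => f' /continuousP cf' ->; apply: cf'.
Qed.

Lemma homeomorphism_closed_image A : closed A -> closed (f @` A).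
Proof.
case: homeomorphism_image_preimage => f' /continuous_closedP cf' ->.
exact: cf'.
Qed.

(** One inclusion is continuity; for the other, the left side is a closed set
    containing [f @` A]. *)
Lemma homeomorphism_image_closure A : f @` closure A = closure (f @` A).
Proof.
apply/seteqP; split=> [_ [x clAx <-] B nB|].
  have [y [Ay By]] := clAx _ (homeo_f.1 x _ nB).
  by exists (f y); split=> //; exists y.
have clF : closed (f @` closure A).
  by apply: homeomorphism_closed_image; apply: closed_closure.
rewrite [X in _ `<=` X](closure_id _).1 //; apply: closureS.
by apply: image_subset; apply: subset_closure.
Qed.

End Homeomorphism.

Lemma closure_bigcup_finite (T : topologicalType) (I : choiceType) (D : set I)
    (F : I -> set T) :
  cardinality.finite_set D ->
  closure (\bigcup_(i in D) F i) = \bigcup_(i in D) closure (F i).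
Proof.
move=> finD; apply/seteqP; split=> [|x [i Di]]; last first.
  by apply: closureS => y Fy; exists i.
have clU : closed (\bigcup_(i in D) closure (F i)).
  by apply: closed_bigcup => // i _; apply: closed_closure.
rewrite [X in _ `<=` X](closure_id _).1 //; apply: closureS => x [i Di Fx].
by exists i => //; apply: subset_closure.
Qed.

(** * Coset representatives *)

(** The condition only compares each [g nu] with earlier ones, yet it is
    symmetric because [x \in y *: L] is. *)
Lemma successive_reps_inj (gT : finGroupType) (L : {group gT}) n
    (g : 'I_n -> gT) :
  (forall nu lambda : 'I_n, (lambda < nu)%N -> g nu \notin g lambda *: L) ->
  forall nu lambda, g nu \in g lambda *: L -> nu = lambda.
Proof.
move=> gL nu lambda gnu; apply: val_inj => /=.
case: (ltngtP lambda nu) => // [lt|lt].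
  by move: (gL _ _ lt); rewrite gnu.
by move: (gL _ _ lt); rewrite lcoset_sym gnu.
Qed.

(** An injection of the indices into the [#|G : L|] cosets is onto. *)
Lemma successive_reps_cover (gT : finGroupType) (G L : {group gT}) n
    (g : 'I_n -> gT) :
  n = #|G : L| -> (forall nu, g nu \in G) ->
  (forall nu lambda : 'I_n, (lambda < nu)%N -> g nu \notin g lambda *: L) ->
  forall x, x \in G -> exists nu, x \in g nu *: L.
Proof.
move=> nE gG gL x Gx.
pose cosets : {set {set gT}} := finset.imset (fun nu => g nu *: L) (mem 'I_n).
have inj : injective (fun nu => g nu *: L).
  move=> nu lambda /= /lcoset_eqP; exact: successive_reps_inj.
have sub : cosets \subset lcosets L G.
  apply/fintype.subsetP=> _ /imsetP[nu _ ->]; apply/lcosetsP.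
  by exists (g nu).
have eq_cosets : cosets = lcosets L G.
  apply/eqP; rewrite eqEcard sub card_lcosets -nE /cosets card_imset //.
  by rewrite card_ord leqnn.
have : x *: L \in lcosets L G by apply/lcosetsP; exists x.
by rewrite -eq_cosets => /imsetP[nu _ /lcoset_eqP]; exists nu.
Qed.

(** * Admissible sets *)

Section Admissible.

Variables (gT : finGroupType) (G : {group gT}) (M : Type) (to : action G M).
Variable H : {group gT}.
Hypothesis sHG : H \subset G.

Local Notation K := (actker_group to).

Lemma coset_reps_decomp sigma k :
  coset_reps to H sigma -> k \in K ->
  exists s c, [/\ s \in sigma, c \in H & k = s * c].
Proof.
case=> _ reps Kk.
have /reps/eqP/cards1P[s sigmaE] : k *: (K :&: H) \in lcosets (K :&: H) K.
  by apply/lcosetsP; exists k.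
have /finset.setIP[sigma_s] : s \in sigma :&: k *: (K :&: H).
  by rewrite sigmaE set11.
rewrite lcoset_sym => /lcosetP[c /finset.setIP[_ Hc] kE].
by exists s, c.
Qed.

Lemma kernel_joingE : K <*> H = K * H.
Proof.
apply: norm_joinEr; apply: fintype.subset_trans sHG _.
exact: normal_norm (actker_normal to).
Qed.

(** Product formula: [#|K| * #|H| = #|K * H| * #|K :&: H|]. *)
Lemma theta_index : theta to H = #|G : K <*> H|.
Proof.
have sKG : K \subset G := normal_sub (actker_normal to).
have sLG : K <*> H \subset G by rewrite join_subG sKG sHG.
rewrite /theta -divgS //= kernel_joingE finset.setIC [(#|H| * _)%N]mulnC.
by rewrite (mul_cardG K H) divnMr ?cardG_gt0.
Qed.

(** Since [sigma lambda] represents [K] modulo [K :&: H], the cosets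
    [g lambda * s *: H] excluded for [g nu] fill up [g lambda *: (K <*> H)]. *)
Lemma admissible_coset_family n (g : 'I_n -> gT) (sigma : 'I_n -> {set gT}) :
  (forall nu, coset_reps to H (sigma nu)) ->
  (forall (nu lambda : 'I_n) s, (lambda < nu)%N -> s \in sigma lambda ->
    g nu \notin (g lambda * s) *: H) ->
  forall nu lambda : 'I_n, (lambda < nu)%N -> g nu \notin g lambda *: (K <*> H).
Proof.
move=> reps gH nu lambda lt; apply/negP=> /lcosetP[kh].
rewrite kernel_joingE => /mulsgP[k h Kk Hh ->] gE.
have [s [c [sigma_s Hc kE]]] := coset_reps_decomp (reps lambda) Kk.
apply: (negP (gH _ _ _ lt sigma_s)); apply/lcosetP; exists (c * h).
  exact: groupM.
by rewrite gE kE !mulgA.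
Qed.

Variable S : {set gT}.
Hypothesis S_adm : admissible to H S.

Lemma admissible_sub : S \subset G.
Proof.
case: S_adm => g [sigma [gG reps _ SE]].
apply/fintype.subsetP=> t /SE[nu [s [sigma_s ->]]]; rewrite groupM //.
apply: (fintype.subsetP (normal_sub (actker_normal to))).
exact: (fintype.subsetP (reps nu).1).
Qed.

Lemma admissible_cover x :
  x \in G -> exists s h, [/\ s \in S, h \in H & x = s * h].
Proof.
case: S_adm => g [sigma [gG reps gH SE]] Gx.
have gKH := admissible_coset_family reps gH.
have [nu /lcosetP[kh]] := successive_reps_cover theta_index gG gKH Gx.
rewrite /= kernel_joingE => /mulsgP[k h Kk Hh ->] ->.
have [s [c [sigma_s Hc ->]]] := coset_reps_decomp (reps nu) Kk.
exists (g nu * s), (c * h); split; last by rewrite !mulgA.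
  by apply/SE; exists nu, s.
exact: groupM.
Qed.

(** Distinct indices give distinct cosets of [K <*> H], and for a fixed index
    the elements differ only by factors from [K]. *)
Lemma admissible_same_coset s t :
  s \in S -> t \in S -> t^-1 * s \in K <*> H -> t^-1 * s \in K.
Proof.
case: S_adm => g [sigma [gG reps gH SE]].
move=> /SE[nu [a [sigma_a ->]]] /SE[lambda [b [sigma_b ->]]] stL.
have Ka : a \in K := fintype.subsetP (reps nu).1 a sigma_a.
have Kb : b \in K := fintype.subsetP (reps lambda).1 b sigma_b.
have sKL : {subset K <= K <*> H} := fintype.subsetP (joing_subl _ _).
have nu_lambda : nu = lambda.
  apply: (successive_reps_inj (admissible_coset_family reps gH)).
  rewrite mem_lcoset -(groupMr _ (sKL _ Ka)) -(groupMl _ (groupVr (sKL _ Kb))).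
  by move: stL; rewrite invMg !mulgA.
by rewrite nu_lambda invMg -mulgA mulKg groupM ?groupV.
Qed.

End Admissible.

(** * The domain of the subgroup *)

Theorem proposition6 (M : topologicalType) (gT : finGroupType)
  (G : {group gT}) (to : action G M)
  (to_homeo : acts_by_homeomorphisms to)
  (quo_free : @fixed_point_free _ (G / actker to)%G _ (kquo_action to))
  (E : set M) (E_dom : elementary_domain to E)
  (H : {group gT}) (sHG : H \subset G)
  (S : {set gT}) (S_adm : admissible to H S) :
  elementary_domain (to \ sHG)
    (\bigcup_(s in [set` S]) (to^~ s @` E)).
Proof.
have toM x : {in G &, act_morph to x} by case: (to) => ? [].
have SG : {subset S <= G} := fintype.subsetP (admissible_sub S_adm).
have HG : {subset H <= G} := fintype.subsetP sHG.
case: E_dom => openE disjE coverE.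
have closES : closure (\bigcup_(s in [set` S]) (to^~ s @` E)) =
    \bigcup_(s in [set` S]) (to^~ s @` closure E).
  rewrite closure_bigcup_finite; last exact: cardinality.finite_finset.
  apply: eq_bigcupr => s /SG Gs.
  by rewrite (homeomorphism_image_closure (to_homeo s Gs)).
split.
- apply: bigcup_open => s /SG Gs.
  exact: (homeomorphism_open_image (to_homeo s Gs)).
- move=> h1 h2 Hh1 Hh2 h12; rewrite closES; apply/seteqP; split=> // z [].
  case=> _ [s Ss [x Ex <-]] <- [_ [t St [y Ey <-]]] /= eq_yx.
  have [Gs Gt] := (SG _ Ss, SG _ St).
  have [Gh1 Gh2] := (HG _ Hh1, HG _ Hh2).
  (* Contrapositive of condition (A) for G: both translates contain
     to x (s * h1). *)
  have [k Kk shE] : exists2 k, k \in actker to & s * h1 = t * h2 * k.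
    apply: contrapT => nk.
    have /seteqP[disj _] : (to^~ (s * h1) @` E) `&`
        (to^~ (t * h2) @` closure E) = set0.
      by apply: disjE => [||k Kk shE]; rewrite ?groupM //; apply: nk; exists k.
    apply: (disj (to x (s * h1))); split; first by exists x.
    by exists y; rewrite // !toM.
  have tsE : t^-1 * s = h2 * k * h1^-1.
    by apply: (mulgI t); apply: (mulIg h1); rewrite mulKVg shE !mulgA mulgKV.
  have Kts : t^-1 * s \in actker_group to.
    apply: (admissible_same_coset sHG S_adm Ss St); rewrite tsE.
    by rewrite !groupM ?groupV // mem_gen // finset.in_setU ?Hh1 ?Hh2 ?Kk ?orbT.
  (* h2^-1 * h1 is the conjugate of (t^-1 * s)^-1 by h2, times k. *)
  have Kh : h2^-1 * h1 \in actker_group to.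
    have -> : h2^-1 * h1 = (t^-1 * s)^-1 ^ h2 * k.
      by rewrite tsE conjgE !invMg !invgK !mulgA mulgKV mulgKV.
    rewrite groupM // memJ_norm ?groupV //.
    exact: (fintype.subsetP (normal_norm (actker_normal to))).
  apply: (h12 (h2^-1 * h1)); last by rewrite mulKVg.
  by rewrite actker_ract finset.in_setI Kh groupM ?groupV.
- apply/seteqP; split=> // z _; rewrite closES.
  have : [set: M] z by [].
  rewrite -coverE => -[x /= Gx [y Ey <-]].
  have [s [h [Ss Hh ->]]] := admissible_cover sHG S_adm Gx.
  exists h => //; exists (to y s).
    by exists s => //; exists y.
  exact: esym (toM _ _ _ (SG s Ss) (HG h Hh)).
Qed.
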